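(* Let $n\geq2$, $k\geq1$, and let $c_k$ be any symplectic $k$-capacity on $\mathbb{C}^n$, with capacity ratio $\widehat{c}_k(B)=c_k(B)/\mathrm{vol}(B,\omega)^{1/n}$. (i) The local maximizers of the capacity ratio $\widehat{c}_k$ on the space of $2n$-dimensional ellipsoids are precisely those rational ellipsoids $E$ such that $k\in K(E)$. (ii) Let $q\geq0$ and $r\in\{1,\dots,n\}$ be the integers such that $k=qn+r$. The global maximum of $\widehat{c}_k$ on the space of $2n$-dimensional ellipsoids is $$\max_{\boldsymbol a}\ \widehat{c}_k(E(\boldsymbol a))=(q+1)^{\frac{n-r+1}{n}}(q+2)^{\frac{r-1}{n}}.$$ Up to permuting the entries of $\boldsymbol a=(a_1,\dots,a_n)$, the global maximizers are precisely those rational ellipsoids $E(\boldsymbol a)$ such that $$\frac{a_i}{a_n}=\begin{cases}\dfrac{q+1}{q+2}, & \text{if } r>1 \text{ and } 1\leq i\leq r-1,\\[2mm] 1, & \text{if } r\leq i\leq n.\end{cases}$$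
   Context: $\mathbb{C}^n$ carries the standard symplectic form $\omega=\sum_j dx_j\wedge dy_j$, and $\mathrm{vol}(B,\omega)$ is the integral of $\omega^n$ over $B$ (so $\mathrm{vol}(E(\boldsymbol a),\omega)=a_1\cdots a_n$). For $\boldsymbol a=(a_1,\dots,a_n)\in(0,\infty]^n$ set $E(\boldsymbol a)=\{z\in\mathbb{C}^n : \sum_j|z_j|^2/a_j\leq1/\pi\}$. If all $a_j$ are finite, $E(\boldsymbol a)$ is an ellipsoid; the space of $2n$-dimensional ellipsoids is parametrized by $\boldsymbol a\in(0,\infty)^n$ (with the corresponding topology). It is rational if all ratios $a_j/a_h$ are rational. A symplectic $k$-capacity on $\mathbb{C}^n$ is a function $c_k:2^{\mathbb{C}^n}\to[0,\infty]$ defined on all subsets of $\mathbb{C}^n$ such that: - (Monotonicity) $c_k(U)\leq c_k(V)$ if there is a symplectomorphism $\psi\in\mathrm{Symp}(\mathbb{C}^n,\omega)$ with $\psi(U)\subset V$. - (Conformality) $c_k(bU)=b^2c_k(U)$ for all $b\in\mathbb{R}$, $U\subset\mathbb{C}^n$. - (Normalization) For each $\boldsymbol a\in(0,\infty]^n$ with $a_1<\infty$, if $\tau_1<\tau_2<\dots$ are the positive integer multiples of the entries $a_j$ listed in increasing order, then $c_k(E(\boldsymbol a))$ is the $k$-th element of the sequence in which each $\tau_h$ is repeated $m_h$ times, $m_h$ being the number of indices $j$ for which $\tau_h$ is a positive multiple of $a_j$. For a rational ellipsoid $E=E(\boldsymbol a)$, $\tau(E)$ is the least common multiple of $a_1,\dots,a_n$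 (the smallest positive real number that is a positive integer multiple of every $a_j$). For $m\geq1$, $k_m(E)$ is the minimal integer $k\geq1$ such that $c_k(E)=m\,\tau(E)$ (independent of the choice of $k$-capacities), and $K(E)=\{k_m(E) : m\geq1\}$. *)

(* Defs.v *)
From HB Require Import structures.
From mathcomp Require Import all_boot all_order all_algebra.
From mathcomp Require Import all_classical all_reals all_analysis.

Set Implicit Arguments.
Unset Strict Implicit.
Unset Printing Implicit Defensive.
Import Order.TTheory GRing.Theory Num.Theory.
Import numFieldNormedType.Exports.

Local Open Scope classical_set_scope.
Local Open Scope ring_scope.

Definition least {d} {T : porderType d} (A : set T) (x : T) : Prop :=
  A x /\ lbound A x.

(* C^n is R^n x R^n, the point z = x + i y being the row vector (x, y). *)
Definition Cn (R : realType) (n : nat) := 'rV[R]_(n + n).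

Definition Re_at (R : realType) (n : nat) (z : Cn R n) (j : 'I_n) : R :=
  z 0 (lshift n j).
Definition Im_at (R : realType) (n : nat) (z : Cn R n) (j : 'I_n) : R :=
  z 0 (rshift n j).

Definition omega (R : realType) (n : nat) (u v : Cn R n) : R :=
  \sum_(j < n) (Re_at u j * Im_at v j - Im_at u j * Re_at v j).

(* The maps of class C^p; for p.+1, continuity of the differential is that of
   x |-> 'd f x v for each v, the dimension being finite. *)
Fixpoint class_C (R : realType) (m : nat) (p : nat)
    (f : 'rV[R]_m -> 'rV[R]_m) : Prop :=
  match p with
  | 0 => continuous f
  | q.+1 => (forall x, differentiable f x) /\
            (forall v, class_C q (fun x => 'd f x v))
  end.

Definition smooth (R : realType) (m : nat) (f : 'rV[R]_m -> 'rV[R]_m) : Prop :=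
  forall p, class_C p f.

Definition symplectomorphism (R : realType) (n : nat)
    (psi : Cn R n -> Cn R n) : Prop :=
  [/\ smooth psi,
      exists phi, [/\ smooth phi, cancel psi phi & cancel phi psi]
    & forall p u v, omega ('d psi p u) ('d psi p v) = omega u v].

(* Lebesgue measure on R^m as the iterated product measure: the product of two
   measures is the integral over the first factor of the measure of the slices
   (product_measure1). *)
Fixpoint lebesgue_vol (R : realType) (m : nat) : set 'rV[R]_m -> \bar R :=
  match m with
  | 0 => fun B => (\1_B 0)%:E
  | m'.+1 => fun B => (\int[@lebesgue_measure R]_t
      lebesgue_vol [set v : 'rV[R]_m' | B (row_mx t%:M v)])%E
  end.

(* omega^n = n! dx_1 /\ dy_1 /\ ... /\ dx_n /\ dy_n *)
Definition vol (R : realType) (n : nat) (B : set (Cn R n)) : \bar R :=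
  ((n`!%:R)%:E * lebesgue_vol B)%E.

(* An entry a j = +oo contributes 0, since (+oo)^-1 = 0 in \bar R. *)
Definition gen_ellipsoid (R : realType) (n : nat) (a : 'I_n -> \bar R) :
    set (Cn R n) :=
  [set z | (\sum_(j < n) (Re_at z j ^+ 2 + Im_at z j ^+ 2)%:E / a j
            <= (pi^-1)%:E)%E].

Definition ellipsoid (R : realType) (n : nat) (a : 'rV[R]_n) : set (Cn R n) :=
  gen_ellipsoid (fun j => (a 0 j)%:E).

Definition positive (R : realType) (n : nat) : set 'rV[R]_n :=
  [set a | forall j, 0 < a 0 j].

(* No real t is a positive multiple of +oo. *)
Definition pos_multiple (R : realType) (a : \bar R) (t : R) : Prop :=
  exists2 m : nat, (0 < m)%N & t%:E = ((m%:R)%:E * a)%E.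

Definition enumerates_multiples (R : realType) (n : nat)
    (a : 'I_n -> \bar R) (tau : nat -> R) : Prop :=
  {homo tau : h l / (h < l)%N >-> h < l} /\
  range tau = [set t | exists j, pos_multiple (a j) t].

Definition multiplicity (R : realType) (n : nat) (a : 'I_n -> \bar R) (t : R) :
    nat :=
  #|[pred j | `[< pos_multiple (a j) t >]]|.

(* The k-th element (k >= 1) of the sequence listing each tau h as many times as
   its multiplicity. Multiplicities are positive, so k blocks suffice. *)
Definition kth_multiple (R : realType) (n : nat) (a : 'I_n -> \bar R)
    (tau : nat -> R) (k : nat) : R :=
  nth 0 (flatten [seq nseq (multiplicity a (tau h)) (tau h) | h <- iota 0 k])
    k.-1.

Definition monotone_capacity (R : realType) (n : nat)
    (c : set (Cn R n) -> \bar R) : Prop :=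
  forall (U V : set (Cn R n)) (psi : Cn R n -> Cn R n),
    symplectomorphism psi -> psi @` U `<=` V -> (c U <= c V)%E.

Definition conformal_capacity (R : realType) (n : nat)
    (c : set (Cn R n) -> \bar R) : Prop :=
  forall (b : R) (U : set (Cn R n)),
    c [set b *: z | z in U] = ((b ^+ 2)%:E * c U)%E.

(* [val j = 0%N] singles out the first entry. *)
Definition normalized_capacity (R : realType) (n k : nat)
    (c : set (Cn R n) -> \bar R) : Prop :=
  forall a : 'I_n -> \bar R,
    (forall j, (0 < a j)%E) -> (forall j, val j = 0%N -> (a j < +oo)%E) ->
    forall tau, enumerates_multiples a tau ->
      c (gen_ellipsoid a) = (kth_multiple a tau k)%:E.

Definition symplectic_capacity (R : realType) (n k : nat)
    (c : set (Cn R n) -> \bar R) : Prop :=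
  [/\ forall U, (0 <= c U)%E, monotone_capacity c, conformal_capacity c
    & normalized_capacity k c].

Definition capacity_ratio (R : realType) (n : nat)
    (c : set (Cn R n) -> \bar R) (B : set (Cn R n)) : \bar R :=
  (c B / (vol B `^ (n%:R^-1)))%E.

Definition rational_ellipsoid (R : realType) (n : nat) (a : 'rV[R]_n) : Prop :=
  forall j h, exists x : rat, a 0 j / a 0 h = ratr x.

(* t = tau(E(a)) *)
Definition is_period (R : realType) (n : nat) (a : 'rV[R]_n) (t : R) : Prop :=
  least [set s : R | 0 < s /\ forall j, pos_multiple (a 0 j)%:E s] t.

(* k = k_m(E(a)), computed with the sequence of capacities c_1, c_2, ...; on
   ellipsoids these are determined by normalized_capacity alone, so k_m does not
   depend on the sequence. *)
Definition is_km (R : realType) (n : nat) (c : nat -> set (Cn R n) -> \bar R)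
    (a : 'rV[R]_n) (m k : nat) : Prop :=
  exists2 t, is_period a t &
    least [set j : nat | (1 <= j)%N /\ c j (ellipsoid a) = (m%:R * t)%:E] k.

Definition K (R : realType) (n : nat) (c : nat -> set (Cn R n) -> \bar R)
    (a : 'rV[R]_n) : set nat :=
  [set k | exists2 m, (1 <= m)%N & is_km c a m k].

Definition local_maximizer (R : realType) (n : nat) (f : 'rV[R]_n -> \bar R)
    (a : 'rV[R]_n) : Prop :=
  positive a /\ \forall b \near a, positive b -> (f b <= f a)%E.

Definition global_maximizer (R : realType) (n : nat) (f : 'rV[R]_n -> \bar R)
    (a : 'rV[R]_n) : Prop :=
  positive a /\ forall b, positive b -> (f b <= f a)%E.

(* Main.v *)
Require Import Defs.
From HB Require Import structures.
From mathcomp Require Import all_boot all_order all_algebra all_fingroup.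
From mathcomp Require Import all_classical all_reals all_analysis.
From mathcomp Require Import ring lra zify.
Set Implicit Arguments.
Unset Strict Implicit.
Unset Printing Implicit Defensive.
Import Order.TTheory GRing.Theory Num.Theory.
Import numFieldNormedType.Exports.
Local Open Scope classical_set_scope.
Local Open Scope ring_scope.

(** The capacity c_k of E(a) is the k-th multiple T of the entries a_j, and the
    volume of E(a) is the product of the a_j, so up to the power 1/n the ratio
    is T^n / prod_j a_j.

    T is the k-th multiple when fewer than k multiples lie below T and at least
    k lie at or below it. Since ceil(T/a_j) - 1 multiples of a_j lie below T and
    floor(T/a_j) at or below it, this reads
      sum_j ceil(T/a_j) < k + n   and   k <= sum_j floor(T/a_j),
    see is_kth_multiple; such a T is unique, and it exists because the multiples
    can be listed in increasing order (multiple_enumP, kth_multipleP).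

    Everything turns on the ellipsoids called balanced here: T = p_j a_j for
    integers p_j with sum_j p_j = k + n - 1. Then all n sequences of multiples
    meet at T and exactly k - 1 multiples lie below T, which says that k is the
    least index of the capacity value T, a multiple of the period
    (mem_K_balanced).

    Local maximizers. If E(a) is not balanced, some entry a_j can be decreased
    slightly without changing the k-th multiple: either T is no multiple of a_j,
    or there is room for one more multiple below T. The volume then drops, so
    the ratio was not locally maximal (local_maximizer_balanced). If E(a) is
    balanced and b is near a, then every p_h b_h exceeds all (p_j - 1) b_j; a
    k-th multiple above some p_h b_h would have too many multiples below it, so
    it is at most every p_h b_h, hence at most their geometric mean, and the
    ratio at b is at most (prod_j p_j)^(1/n), its value at a
    (balanced_local_maximizer).

    Global maximizers. For any a put p_j = ceil(T/a_j). Then T <= p_j a_j, so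
    the ratio is at most (prod_j p_j)^(1/n), where the positive integers p_j
    have sum at most k + n - 1 = n(q+1) + (r-1). Among such integers the product
    is largest exactly when the sum is attained and every p_j is q+1 or q+2
    (prod_le_geometric). Equality throughout forces E(a) to be balanced with
    these p_j, which is the asserted shape because a_j = T/p_j
    (balanced_shapeP).

    The volume is computed by slicing off one real coordinate at a time, which
    produces the integrals of cos^m over [-pi/2, pi/2]; two consecutive ones
    have product 2 pi / (m + 1), whence the factor pi^n / n! of the ball
    (vol_ellipsoid). *)

(** * Powers of the cosine *)

Definition cos_power_integral (R : realType) (m : nat) : R :=
  \int[lebesgue_measure]_(x in `[- (pi / 2), pi / 2]) (cos x ^+ m).

Lemma Rintegral_continuous_derive (R : realType) (F f : R -> R) (a b : R) :
  a < b -> continuous f -> (forall x : R, is_derive x 1 F (f x)) ->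
  \int[lebesgue_measure]_(x in `[a, b]) f x = F b - F a.
Proof.
move=> ab cf dF.
have cF : continuous F.
  by move=> x; apply/differentiable_continuous/derivable1_diffP.
rewrite /Rintegral (@continuous_FTC2 _ f F) //.
- exact: continuous_subspaceT.
- split=> [x _||].
  + by apply: ex_derive.
  + apply: cvg_at_right_filter; exact: cF.
  + apply: cvg_at_left_filter; exact: cF.
- by move=> x _; rewrite derive1E derive_val.
Qed.

Lemma pihalfN_lt (R : realType) : - (pi / 2) < pi / 2 :> R.
Proof. by have := pi_gt0 R; lra. Qed.

Lemma continuous_cosX (R : realType) m : continuous (fun x : R => cos x ^+ m).
Proof.
move=> x; apply: (@continuous_comp _ _ _ cos (fun y => y ^+ m)).
  exact: continuous_cos.
exact: exprn_continuous.
Qed.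

Lemma continuous_integrable_itv (R : realType) (f : R -> R) (a b : R) :
  continuous f -> (@lebesgue_measure R).-integrable `[a, b] (EFin \o f).
Proof.
move=> cf; apply: continuous_compact_integrable; first exact: segment_compact.
exact: continuous_subspaceT.
Qed.

Lemma cos_power_integral0 (R : realType) : cos_power_integral R 0 = pi.
Proof.
rewrite /cos_power_integral.
under eq_Rintegral do rewrite expr0.
rewrite (@Rintegral_continuous_derive _ id (fun=> 1)) ?pihalfN_lt//.
- by field.
- exact: cst_continuous.
Qed.

Lemma cos_power_integral1 (R : realType) : cos_power_integral R 1 = 2.
Proof.
rewrite /cos_power_integral.
under eq_Rintegral do rewrite expr1.
rewrite (@Rintegral_continuous_derive _ sin cos) ?pihalfN_lt//.
- by rewrite sinN sin_pihalf; ring.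
- exact: continuous_cos.
Qed.

(** Integrating the derivative of cos^(m+1) sin, which vanishes at both ends,
    gives the recurrence without any integration by parts. *)
Lemma cos_power_integral_rec (R : realType) m :
  m.+2%:R * cos_power_integral R m.+2 = m.+1%:R * cos_power_integral R m.
Proof.
apply/eqP; rewrite -subr_eq0; apply/eqP.
have key : \int[lebesgue_measure]_(x in `[- (pi / 2), pi / 2])
    (m.+2%:R * cos x ^+ m.+2 - m.+1%:R * cos x ^+ m) = 0 :> R.
  have dF (x : R) : is_derive x 1 (fun x => cos x ^+ m.+1 * sin x)
      (m.+2%:R * cos x ^+ m.+2 - m.+1%:R * cos x ^+ m).
    have dX := is_deriveX m.+1 (is_derive_cos x).
    have := is_deriveM dX (is_derive_sin x).
    rewrite (_ : _ * _ = (fun x => cos x ^+ m.+1 * sin x)); last first.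
      by apply/funext => y; rewrite /GRing.mul/= fctE.
    move=> h; apply: (is_derive_eq h).
    rewrite /GRing.scale/= fctE/= !exprS.
    have s2 : sin x * sin x = 1 - cos x * cos x by rewrite -!expr2 sin2cos2.
    transitivity (cos x * cos x ^+ m * cos x
                  - m.+1%:R * cos x ^+ m * (sin x * sin x)); first by ring.
    by rewrite s2; ring.
  rewrite (Rintegral_continuous_derive _ _ dF) ?pihalfN_lt//.
  - by rewrite cosN cos_pihalf !expr0n/= !mul0r subrr.
  - move=> x; apply: cvgB.
      by apply: cvgM; [exact: cvg_cst|exact: continuous_cosX].
    by apply: cvgM; [exact: cvg_cst|exact: continuous_cosX].
rewrite -[RHS]key /cos_power_integral RintegralB//=.
- by rewrite !RintegralZl//; apply: continuous_integrable_itv;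
    exact: continuous_cosX.
- apply: (@continuous_integrable_itv _ (fun x => m.+2%:R * cos x ^+ m.+2)).
  by move=> x; apply: cvgM; [exact: cvg_cst|exact: continuous_cosX].
- apply: (@continuous_integrable_itv _ (fun x => m.+1%:R * cos x ^+ m)).
  by move=> x; apply: cvgM; [exact: cvg_cst|exact: continuous_cosX].
Qed.

(** By the recurrence the left-hand side does not depend on m. Only products of
    two consecutive integrals are needed, as the dimension 2n is even. *)
Lemma cos_power_integral_mul (R : realType) m :
  m.+1%:R * cos_power_integral R m * cos_power_integral R m.+1 = 2 * pi.
Proof.
elim: m => [|m <-].
  by rewrite cos_power_integral0 cos_power_integral1; ring.
rewrite mulrAC cos_power_integral_rec; ring.
Qed.

(** * The volume of an ellipsoid *)

(** The measure of the slice of an ellipsoid at height t is, up to a constant, a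
    power of the square root of s - t^2/b. The substitution t = sqrt (b s) sin x
    turns the integral over the slices into one of a power of the cosine. The
    boolean factor matters only for m = 0, where the power alone would not
    vanish on the empty slices. *)
Lemma ball_slice_integral (R : realType) (m : nat) (b C s : R) : 0 < b ->
  (\int[lebesgue_measure]_t
     (C * ((0 <= s - t ^+ 2 / b)%R%:R * Num.sqrt (s - t ^+ 2 / b) ^+ m))%:E)%E =
  (C * cos_power_integral R m.+1 * Num.sqrt b *
     ((0 <= s)%R%:R * Num.sqrt s ^+ m.+1))%:E.
Proof.
move=> b0; have [s0|s0] := ltP s 0.
  rewrite mul0r mulr0; under eq_integral => t _.
    have : s - t ^+ 2 / b < 0.
      by have : 0 <= t ^+ 2 / b by [rewrite divr_ge0 ?sqr_ge0 ?ltW]; lra.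
    move=> /lt_geF ->; rewrite mul0r mulr0; over.
  by rewrite integral0.
rewrite mul1r.
set rho := Num.sqrt b * Num.sqrt s.
have rho2 : rho ^+ 2 = s * b
  by rewrite exprMn (sqr_sqrtr (ltW b0)) (sqr_sqrtr s0) mulrC.
have rho_ge0 : 0 <= rho by rewrite mulr_ge0 ?sqrtr_ge0.
pose G t := C * Num.sqrt (s - t ^+ 2 / b) ^+ m.
have slice t : (0 <= s - t ^+ 2 / b) = (t \in `[- rho, rho]).
  rewrite subr_ge0 ler_pdivrMr// -rho2 -(real_normK (num_real t)).
  by rewrite ler_sqr ?nnegrE// in_itv/= ler_norml.
transitivity (\int[lebesgue_measure]_(t in `[(- rho)%R, rho]) (G t)%:E)%E.
  rewrite [RHS]integral_mkcond; apply: eq_integral => t _.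
  rewrite slice patchE mem_setE; case: (t \in `[- rho, rho]).
    by rewrite mul1r.
  by rewrite mul0r mulr0.
have cs : continuous (fun t : R => s - t ^+ 2 / b).
  move=> t; apply: cvgB; first exact: cvg_cst.
  by apply: cvgM; [exact: exprn_continuous|exact: cvg_cst].
have csqrt : continuous (fun t : R => Num.sqrt (s - t ^+ 2 / b)).
  by move=> t; apply: (continuous_comp (cs t)); exact: sqrt_continuous.
have cG : continuous G.
  move=> t; apply: cvgM; first exact: cvg_cst.
  exact: (@continuous_comp _ _ _ _ (fun y : R => y ^+ m) t (csqrt t)
    (@exprn_continuous _ m _)).
have [rho0|] := eqVneq rho 0.
  rewrite rho0 oppr0 set_itv1 integral_set1; congr (_%:E).
  by rewrite exprS mulrA -[_ * Num.sqrt b * _]mulrA -/rho rho0 mulr0 mul0r.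
move=> rho_neq0.
have rho_gt0 : 0 < rho by rewrite lt_neqAle eq_sym rho_neq0.
pose F (x : R) := rho * sin x.
have dF (x : R) : is_derive x 1 F (rho * cos x).
  exact: is_deriveZ.
have F' : derive1 F = (fun x => rho * cos x).
  by apply/funext => x; rewrite derive1E derive_val.
have cF' : continuous (fun x : R => rho * cos x).
  by move=> x; apply: cvgM; [exact: cvg_cst|exact: continuous_cos].
have cF : continuous F.
  by move=> x; apply: cvgM; [exact: cvg_cst|exact: continuous_sin].
have Fa : F (- (pi / 2)) = - rho by rewrite /F sinN sin_pihalf mulrN1.
have Fb : F (pi / 2) = rho by rewrite /F sin_pihalf mulr1.
rewrite -{1}Fa -Fb (@integration_by_substitution_increasing _ F).
- rewrite F'.
  transitivity (\int[lebesgue_measure]_(x in `[(- (pi / 2))%R, (pi / 2)%R])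
    ((C * Num.sqrt s ^+ m * rho)%:E * (cos x ^+ m.+1)%:E))%E.
    apply: eq_integral => x; rewrite inE/= in_itv/= => xI.
    rewrite -EFinM; congr (_%:E); rewrite fctE /G /F /=.
    rewrite exprMn rho2.
    have -> : s - s * b * sin x ^+ 2 / b = s * cos x ^+ 2.
      by rewrite cos2sin2; field; rewrite gt_eqF.
    rewrite sqrtrM// sqrtr_sqr ger0_norm ?cos_ge0_pihalf// exprMn exprS; ring.
  rewrite integralZl//; last first.
    by apply: continuous_integrable_itv; exact: continuous_cosX.
  rewrite -[X in (_ * X)%E]fineK; last first.
    apply: integrable_fin_num => //.
    by apply: continuous_integrable_itv; exact: continuous_cosX.
  rewrite -EFinM; congr (_%:E); rewrite -[fine _]/(cos_power_integral R m.+1).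
  by rewrite /rho exprS; ring.
- exact/ltW/pihalfN_lt.
- move=> x y xI yI xy; rewrite /F ltr_pM2l//; by rewrite ltr_sin.
- by rewrite F' => x _; exact: cF'.
- by rewrite F'; apply: cvgP; apply: cvg_at_right_filter; exact: cF'.
- by rewrite F'; apply: cvgP; apply: cvg_at_left_filter; exact: cF'.
- split=> [x _||].
  + by apply: ex_derive.
  + by apply: cvg_at_right_filter; exact: cF.
  + by apply: cvg_at_left_filter; exact: cF.
- exact: continuous_subspaceT.
Qed.

Definition cos_power_product (R : realType) (m : nat) : R :=
  \prod_(i < m) cos_power_integral R i.+1.

(** The semi-axes are handled one at a time by [ball_slice_integral]; keeping the
    level s arbitrary makes the induction go through, since slicing lowers it. *)
Lemma lebesgue_vol_ellipsoid (R : realType) (m : nat) (b : 'I_m -> R) (s : R) :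
  (forall i, 0 < b i) ->
  lebesgue_vol [set v : 'rV[R]_m | \sum_i v 0 i ^+ 2 / b i <= s] =
  (cos_power_product R m * \prod_i Num.sqrt (b i) *
     ((0 <= s)%R%:R * Num.sqrt s ^+ m))%:E.
Proof.
elim: m => [|m IHm] in b s *.
  move=> _ /=; rewrite /cos_power_product !big_ord0 !mul1r expr0 mulr1.
  rewrite indicE; congr (_%:R%:E); congr nat_of_bool.
  apply/idP/idP; first by rewrite inE/= big_ord0.
  by move=> s0; rewrite inE/= big_ord0.
move=> b_gt0 /=.
transitivity (\int[lebesgue_measure]_t
  (cos_power_product R m * \prod_i Num.sqrt (b (lift ord0 i)) *
    ((0 <= s - t ^+ 2 / b ord0)%R%:R *
       Num.sqrt (s - t ^+ 2 / b ord0) ^+ m))%:E)%E.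
  apply: eq_integral => t _; rewrite -IHm//; congr lebesgue_vol.
  have r0 (v : 'rV[R]_m) : (row_mx t%:M v : 'rV_m.+1) 0 ord0 = t.
    have -> : ord0 = lshift m ord0 :> 'I_(1 + m) by exact: val_inj.
    by apply: etrans (row_mxEl _ _ _ _) _; rewrite mxE.
  have rS (v : 'rV[R]_m) i : (row_mx t%:M v : 'rV_m.+1) 0 (lift ord0 i) = v 0 i.
    have -> : lift ord0 i = rshift 1 i :> 'I_(1 + m) by exact: val_inj.
    exact: row_mxEr.
  have sumE (v : 'rV[R]_m) : \sum_i (row_mx t%:M v : 'rV_m.+1) 0 i ^+ 2 / b i =
      t ^+ 2 / b ord0 + \sum_i v 0 i ^+ 2 / b (lift ord0 i).
    by rewrite big_ord_recl r0; under eq_bigr do rewrite rS.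
  by apply/seteqP; split=> v /=; rewrite sumE lerBrDl.
rewrite ball_slice_integral//; congr (_%:E).
rewrite /cos_power_product big_ord_recr/= [in RHS]big_ord_recl/=; ring.
Qed.

(** The unit ball of R^(2n) has volume pi^n / n!. *)
Lemma cos_power_product_even (R : realType) (n : nat) :
  n`!%:R * cos_power_product R (n + n) = pi ^+ n.
Proof.
elim: n => [|n IHn]; first by rewrite /cos_power_product big_ord0 mulr1.
rewrite addSn addnS /cos_power_product !big_ord_recr/=.
rewrite -/(cos_power_product R (n + n)).
rewrite factS natrM exprS -IHn.
have := cos_power_integral_mul R (n + n).+1.
have -> : (n + n).+2%:R = 2 * n.+1%:R :> R by rewrite -natrM; congr (_%:R); lia.
rewrite -!mulrA => /mulfI w2; rewrite -w2 ?pnatr_eq0//; ring.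
Qed.

Lemma vol_ellipsoid (R : realType) (n : nat) (a : 'rV[R]_n) :
  positive a -> vol (ellipsoid a) = (\prod_j a 0 j)%:E.
Proof.
move=> a_gt0.
pose b (i : 'I_(n + n)) :=
  a 0 (match fintype.split i with inl j => j | inr j => j end).
have bl j : b (lshift n j) = a 0 j by rewrite /b (unsplitK (inl _ j)).
have br j : b (rshift n j) = a 0 j by rewrite /b (unsplitK (inr _ j)).
have sumE (z : Cn R n) :
    (\sum_(j < n) (Re_at z j ^+ 2 + Im_at z j ^+ 2)%:E / (a 0 j)%:E)%E =
    (\sum_i z 0 i ^+ 2 / b i)%:E.
  rewrite big_split_ord/= -big_split/= -sumEFin; apply: eq_bigr => j _.
  by rewrite bl br inver gt_eqF// -EFinM mulrDl.
have -> : ellipsoid a =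
    [set v : 'rV[R]_(n + n) | \sum_i v 0 i ^+ 2 / b i <= pi^-1].
  by apply/seteqP; split=> z /=;
    rewrite /ellipsoid /gen_ellipsoid/= sumE lee_fin.
rewrite /vol lebesgue_vol_ellipsoid; last by move=> i; exact: a_gt0.
rewrite -EFinM; congr (_%:E).
have -> : \prod_i Num.sqrt (b i) = \prod_j a 0 j.
  rewrite big_split_ord/= -big_split; apply: eq_bigr => j _.
  by rewrite /= bl br -expr2 sqr_sqrtr// ltW// a_gt0.
rewrite invr_ge0 pi_ge0 mul1r sqrtrV ?pi_ge0// exprD -exprMn -invfM -expr2.
rewrite sqr_sqrtr ?pi_ge0// !mulrA cos_power_product_even mulrAC -exprMn.
by rewrite mulfV ?expr1n ?mul1r// gt_eqF ?pi_gt0.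
Qed.

(** * Counting multiples with floors and ceilings *)

Definition ceiln (R : realType) (x : R) : nat := `|Num.ceil x|%N.

Lemma ceiln_gt_nat (R : realType) (x : R) (m : nat) :
  0 <= x -> (m < ceiln x)%N = (m%:R < x).
Proof.
move=> x0; have c0 : 0 <= Num.ceil x by rewrite ceil_ge0; lra.
by rewrite -(ceil_gt_int x m) /ceiln -ltz_nat gez0_abs.
Qed.

Lemma ceiln_le_nat (R : realType) (x : R) (m : nat) :
  0 <= x -> (ceiln x <= m)%N = (x <= m%:R).
Proof. by move=> x0; rewrite leqNgt ceiln_gt_nat// -leNgt. Qed.

Lemma ceiln_ge (R : realType) (x : R) : 0 <= x -> x <= (ceiln x)%:R.
Proof. by move=> x0; rewrite -ceiln_le_nat. Qed.

Lemma ceiln_natr (R : realType) (m : nat) : ceiln (m%:R : R) = m.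
Proof. by rewrite /ceiln -[m%:R]/((m%:Z)%:~R) intrKceil. Qed.

Lemma truncn_lt_ceiln (R : realType) (x y : R) :
  0 <= x -> x < y -> (Num.truncn x < ceiln y)%N.
Proof.
move=> x0 xy; rewrite ceiln_gt_nat; last by rewrite ltW// (le_lt_trans x0).
by rewrite (le_lt_trans _ xy)// truncn_le.
Qed.

Lemma ceiln_le_truncnS (R : realType) (x : R) :
  0 <= x -> (ceiln x <= (Num.truncn x).+1)%N.
Proof. by move=> x0; rewrite ceiln_le_nat// ltW// truncnS_gt. Qed.

Lemma ceiln_le_truncn_natr (R : realType) (x : R) :
  0 <= x -> (ceiln x <= Num.truncn x)%N -> x = (Num.truncn x)%:R.
Proof.
move=> x0; rewrite ceiln_le_nat// => xle.
by apply/le_anti; rewrite xle truncn_le.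
Qed.

Lemma pos_multipleP (R : realType) (a t : R) :
  pos_multiple a%:E t <-> exists2 m : nat, (0 < m)%N & t = m%:R * a.
Proof. by split=> -[m m0 mE]; exists m => //; [case: mE|rewrite mE]. Qed.

(** The multiples of a that are at most t number floor(t/a), those below t
    number ceil(t/a) - 1, and the two counts differ only if t is a multiple. *)
Lemma truncn_ceiln (R : realType) (a t : R) : 0 < a -> 0 < t ->
  ((Num.truncn (t / a)).+1 = ceiln (t / a) + `[< pos_multiple a%:E t >])%N.
Proof.
move=> a0 t0; have ta0 : 0 <= t / a by rewrite divr_ge0 ?ltW.
case: asboolP => [/pos_multipleP[m _ ->]|nm].
  by rewrite mulfK ?gt_eqF// natrK ceiln_natr addn1.
rewrite addn0; apply/eqP; rewrite eqn_leq ceiln_le_truncnS// andbT.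
rewrite ltnNge; apply: contra_notN nm => /(ceiln_le_truncn_natr ta0) tE.
apply/pos_multipleP; exists (Num.truncn (t / a)); last first.
  by rewrite -tE divfK ?gt_eqF.
by rewrite -(ltr_nat R) -tE divr_gt0.
Qed.

Definition floor_sum (R : realType) (n : nat) (a : 'rV[R]_n) (t : R) : nat :=
  (\sum_j Num.truncn (t / a 0 j)%R)%N.

Definition ceil_sum (R : realType) (n : nat) (a : 'rV[R]_n) (t : R) : nat :=
  (\sum_j ceiln (t / a 0 j)%R)%N.

(** The number of multiples below t is [ceil_sum a t - n] as long as t is
    positive; moving n to the other side avoids the truncated subtraction. *)
Definition is_kth_multiple (R : realType) (n : nat) (a : 'rV[R]_n) (k : nat)
    (t : R) : Prop :=
  [/\ 0 < t, (ceil_sum a t < k + n)%N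
    & (k <= floor_sum a t)%N].

(** For s < t every multiple counted by floor(s/a_j) lies below t, so that at
    least k multiples would lie below t. *)
Lemma is_kth_multiple_unique (R : realType) (n : nat) (a : 'rV[R]_n) (k : nat)
    (s t : R) : positive a ->
  is_kth_multiple a k s -> is_kth_multiple a k t -> s = t.
Proof.
move=> a0.
wlog st : s t / s < t => [H|] sk tk.
  by have [/H->//|/H->//|] := ltgtP s t.
case: sk tk => s0 _ ks [t0 tk _].
suff : (floor_sum a s + n <= ceil_sum a t)%N by lia.
have -> : (floor_sum a s + n = \sum_j (Num.truncn (s / a 0 j)%R).+1)%N.
  rewrite /floor_sum.
  by rewrite -[X in (_ + X)%N]card_ord -sum1_card -big_split;
    apply: eq_bigr => j _ /=; rewrite addn1.
apply: leq_sum => j _; apply: truncn_lt_ceiln.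
  by rewrite divr_ge0 ?ltW.
by rewrite ltr_pM2r ?invr_gt0.
Qed.

Lemma sum_truncn_ceiln (R : realType) (n : nat) (a : 'rV[R]_n) (t : R) :
  positive a -> 0 < t ->
  (floor_sum a t + n =
   ceil_sum a t + multiplicity (fun j => (a 0 j)%:E) t)%N.
Proof.
move=> a0 t0; rewrite /floor_sum /ceil_sum.
rewrite -[X in (_ + X)%N]card_ord -sum1_card -big_split /multiplicity -sum1_card.
rewrite [X in (_ + X)%N]big_mkcond -big_split; apply: eq_bigr => j _ /=.
by rewrite addn1 truncn_ceiln//; case: ifP.
Qed.

(** * The k-th multiple in an increasing enumeration *)

Lemma enumeration_gt0 (R : realType) (n : nat) (a : 'rV[R]_n)
    (tau : nat -> R) : positive a ->
  enumerates_multiples (fun j => (a 0 j)%:E) tau -> forall h, 0 < tau h.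
Proof.
move=> a0 [_ tauE] h.
have [j /pos_multipleP[m m0 ->]] :
    [set t | exists j, pos_multiple (a 0 j)%:E t] (tau h).
  by rewrite -tauE; exists h.
by rewrite mulr_gt0 ?ltr0n.
Qed.

Lemma enumerates_multiples_mono (R : realType) (n : nat) (a : 'I_n -> \bar R)
    (tau : nat -> R) : enumerates_multiples a tau ->
  {mono tau : h l / (h < l)%N >-> h < l}.
Proof.
move=> [tau_incr _] h l; case: (ltngtP h l) => [/tau_incr//|/tau_incr/lt_gtF//|->].
by rewrite ltxx.
Qed.

(** No multiple lies strictly between consecutive values of tau, so the number of
    multiples below tau h is the total multiplicity of the earlier values. *)
Lemma ceil_sum_enumeration (R : realType) (n : nat) (a : 'rV[R]_n)
    (tau : nat -> R) : positive a ->
  enumerates_multiples (fun j => (a 0 j)%:E) tau -> forall h,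
  ceil_sum a (tau h) =
  (\sum_(i < h) multiplicity (fun j => (a 0 j)%:E) (tau i) + n)%N.
Proof.
move=> a0 tauP; have tau0 := enumeration_gt0 a0 tauP.
have tau_lt := enumerates_multiples_mono tauP; case: tauP => _ tauE.
have multiple_tau j m : (0 < m)%N -> exists l, m%:R * a 0 j = tau l.
  move=> m0; have : range tau (m%:R * a 0 j).
    by rewrite tauE; exists j; apply/pos_multipleP; exists m.
  by case=> l _ <-; exists l.
have th0 i j : 0 <= tau i / a 0 j by rewrite divr_ge0 ?ltW.
elim=> [|h IHh].
  rewrite big_ord0 add0n -[RHS]card_ord -sum1_card; apply: eq_bigr => j _.
  apply/eqP; rewrite eqn_leq ceiln_gt_nat// ceiln_le_nat// divr_gt0// andbT.
  rewrite ler_pdivrMr//; have [l ->] := multiple_tau j 1 isT.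
  by rewrite leNgt tau_lt.
rewrite big_ord_recr/= addnAC -IHh -sum_truncn_ceiln//.
rewrite -[X in (_ + X)%N]card_ord -sum1_card -big_split; apply: eq_bigr => j _ /=.
rewrite addn1; apply/eqP; rewrite eqn_leq truncn_lt_ceiln//; last first.
  by rewrite ltr_pM2r ?invr_gt0// tau_lt.
rewrite andbT ceiln_le_nat// ler_pdivrMr//.
have [//|l lE] := multiple_tau j (Num.truncn (tau h / a 0 j)).+1.
rewrite lE leNgt tau_lt -leqNgt -tau_lt -lE -ltr_pdivrMr//.
exact: truncnS_gt.
Qed.

Lemma size_flatten_nseq (T : Type) (m : nat -> nat) (f : nat -> T) (h : nat) :
  size (flatten [seq nseq (m i) (f i) | i <- iota 0 h]) = (\sum_(i < h) m i)%N.
Proof.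
rewrite size_flatten /shape -map_comp sumnE big_map.
rewrite -(big_mkord xpredT m) /index_iota subn0.
by apply: eq_bigr => i _; rewrite /= size_nseq.
Qed.

Lemma nth_flatten_nseq (T : Type) (x0 : T) (m : nat -> nat) (f : nat -> T)
    (h l x : nat) : (h < l)%N ->
  (\sum_(i < h) m i <= x < \sum_(i < h.+1) m i)%N ->
  nth x0 (flatten [seq nseq (m i) (f i) | i <- iota 0 l]) x = f h.
Proof.
move=> hl /andP[hx xh]; rewrite -(subnKC hl) addSnnS iotaD map_cat flatten_cat.
rewrite nth_cat size_flatten_nseq ltnNge hx /= nth_cat size_nseq nth_nseq.
by rewrite ltn_subLR// add0n; move: xh; rewrite big_ord_recr/= => ->.
Qed.

(** The block of tau h occupies the positions from the number of multiples below
    tau h up to the number of those at most tau h, and position k - 1 falls into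
    exactly one block. *)
Lemma kth_multipleP (R : realType) (n k : nat) (a : 'rV[R]_n) (tau : nat -> R) :
  positive a -> (0 < k)%N -> enumerates_multiples (fun j => (a 0 j)%:E) tau ->
  is_kth_multiple a k (kth_multiple (fun j => (a 0 j)%:E) tau k).
Proof.
move=> a0 k0 tauP; pose m i := multiplicity (fun j => (a 0 j)%:E) (tau i).
have m_gt0 i : (0 < m i)%N.
  have [j jP] : [set t | exists j, pos_multiple (a 0 j)%:E t] (tau i).
    by case: tauP => _ <-; exists i.
  by apply/card_gt0P; exists j; apply/asboolP.
have exh : exists h, (k.-1 < \sum_(i < h) m i)%N.
  exists k; rewrite prednK// -[X in (X <= _)%N]card_ord -sum1_card.
  exact: leq_sum.
have [h kh hmin] := ex_minnP exh; case: h => [|h] in kh hmin *.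
  by rewrite big_ord0 in kh.
have hk : (h < k)%N.
  apply: hmin; rewrite prednK// -[X in (X <= _)%N]card_ord -sum1_card.
  exact: leq_sum.
have lehk : (\sum_(i < h) m i <= k.-1)%N.
  by rewrite leqNgt; apply/negP => /hmin; rewrite ltnn.
rewrite /kth_multiple (@nth_flatten_nseq _ _ m _ h)// ?lehk//.
have tau0 := enumeration_gt0 a0 tauP h.
have ceilE := ceil_sum_enumeration a0 tauP h; rewrite -/m in ceilE.
have := sum_truncn_ceiln a0 tau0; rewrite -/(m h) => floorE.
rewrite big_ord_recr/= in kh; split=> //;
  move: ceilE floorE lehk kh; rewrite -/(m _).
all: set u := bigop _ _ _; lia.
Qed.

(** * An increasing enumeration of the multiples *)

Definition next_multiple (R : realType) (n : nat) (a : 'rV[R]_n.+1) (t : R) : R :=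
  let F j := (Num.truncn (t / a 0 j)).+1%:R * a 0 j in
  F [arg min_(j < ord0) F j]%O.

Lemma next_multipleP (R : realType) (n : nat) (a : 'rV[R]_n.+1) (t : R) :
  positive a -> 0 <= t ->
  [/\ t < next_multiple a t,
      exists j, pos_multiple (a 0 j)%:E (next_multiple a t)
    & forall j s, pos_multiple (a 0 j)%:E s -> t < s -> next_multiple a t <= s].
Proof.
move=> a0 t0; rewrite /next_multiple; case: arg_minP => //= i _ imin; split.
- by rewrite -ltr_pdivrMr// truncnS_gt.
- by exists i; apply/pos_multipleP; exists (Num.truncn (t / a 0 i)).+1.
- move=> j s /pos_multipleP[m m0 ->] tm; apply: le_trans (imin j isT) _.
  rewrite ler_pM2r// ler_nat truncn_lt_nat ?divr_ge0 ?(ltW (a0 _))//.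
  by rewrite ltr_pdivrMr.
Qed.

Definition multiple_enum (R : realType) (n : nat) (a : 'rV[R]_n.+1) (h : nat) : R :=
  iter h.+1 (next_multiple a) 0.

(** Every step picks up at least one new multiple; hence the iterates are
    unbounded. *)
Lemma floor_sum_iter_next (R : realType) (n : nat) (a : 'rV[R]_n.+1) (h : nat) :
  positive a ->
  0 <= iter h (next_multiple a) 0 /\
  (h <= floor_sum a (iter h (next_multiple a) (0 : R)%R))%N.
Proof.
move=> a0; elim: h => [|h [t0 IHh]]; first by [].
rewrite iterS; set t := iter h _ _ in t0 IHh *.
have [tt [i /pos_multipleP[m m0 tE]] _] := next_multipleP a0 t0.
have tt0 : 0 < next_multiple a t by exact: le_lt_trans tt.
split; first exact: ltW.
apply: leq_ltn_trans IHh _; rewrite /floor_sum (bigD1 i)//=.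
rewrite [X in (_ < X)%N](bigD1 i)//= -addSn leq_add//.
  rewrite tE mulfK ?gt_eqF// natrK truncn_lt_nat ?divr_ge0 ?(ltW (a0 _))//.
  by rewrite ltr_pdivrMr// -tE.
apply: leq_sum => j _; apply: le_truncn.
by rewrite ler_pM2r ?invr_gt0// ltW.
Qed.

(** A multiple s is reached: at the first iterate that is at least s the
    previous one is below s, and no multiple is skipped in between. *)
Lemma multiple_enumP (R : realType) (n : nat) (a : 'rV[R]_n.+1) :
  positive a -> enumerates_multiples (fun j => (a 0 j)%:E) (multiple_enum a).
Proof.
move=> a0; have t0 h := (floor_sum_iter_next h a0).1.
split.
  apply: homo_ltn; first exact: lt_trans.
  by move=> h; have [] := next_multipleP a0 (t0 h.+1).
apply/seteqP; split=> [_ [h _ <-]|s [j js]].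
  by have [] := next_multipleP a0 (t0 h).
have s0 : 0 < s.
  by move/pos_multipleP: js => [m m0 ->]; rewrite mulr_gt0 ?ltr0n.
have : exists h, s <= iter h (next_multiple a) 0.
  exists (floor_sum a s).+1; rewrite leNgt; apply/negP => /ltW ts.
  have := (floor_sum_iter_next (floor_sum a s).+1 a0).2.
  apply/negP; rewrite -leqNgt; apply: leq_sum => i _; apply: le_truncn.
  by rewrite ler_pM2r ?invr_gt0.
move=> /ex_minnP[[|h] sh hmin]; first by rewrite leNgt s0 in sh.
exists h => //; apply/le_anti; rewrite /multiple_enum sh andbT.
have [_ _] := next_multipleP a0 (t0 h); apply; first exact: js.
by rewrite ltNge; apply/negP => /hmin; rewrite ltnn.
Qed.

Lemma exists_kth_multiple (R : realType) (n k : nat) (a : 'rV[R]_n) :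
  (0 < n)%N -> (0 < k)%N -> positive a -> exists t, is_kth_multiple a k t.
Proof.
case: n a => // n a _ k0 a0.
exists (kth_multiple (fun j => (a 0 j)%:E) (multiple_enum a) k).
exact: (kth_multipleP a0 k0 (multiple_enumP a0)).
Qed.

Lemma capacity_ellipsoid (R : realType) (n k : nat) (c : set (Cn R n) -> \bar R)
    (a : 'rV[R]_n) (t : R) :
  (0 < n)%N -> (0 < k)%N -> normalized_capacity k c -> positive a ->
  is_kth_multiple a k t -> c (ellipsoid a) = t%:E.
Proof.
case: n a c => // n a c _ k0 cn a0 tk.
rewrite /ellipsoid (cn _ _ _ _ (multiple_enumP a0)).
- congr (_%:E); apply: (is_kth_multiple_unique a0 _ tk).
  exact: (kth_multipleP a0 k0 (multiple_enumP a0)).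
- by move=> j; rewrite lte_fin.
- by move=> j _; rewrite ltry.
Qed.

(** * The capacity ratio on ellipsoids *)

Lemma capacity_ratio_ellipsoid (R : realType) (n k : nat)
    (c : set (Cn R n) -> \bar R) (a : 'rV[R]_n) (t : R) :
  (0 < n)%N -> (0 < k)%N -> normalized_capacity k c -> positive a ->
  is_kth_multiple a k t ->
  capacity_ratio c (ellipsoid a) =
  ((t ^+ n / \prod_j a 0 j) `^ (n%:R^-1))%:E.
Proof.
move=> n0 k0 cn a0 tk; have [t0 _ _] := tk.
have P0 : 0 < \prod_j a 0 j by apply: prodr_gt0.
rewrite /capacity_ratio (capacity_ellipsoid n0 k0 cn a0 tk) vol_ellipsoid//.
rewrite poweR_EFin inver gt_eqF ?powR_gt0// -EFinM; congr (_%:E).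
rewrite powRM ?exprn_ge0 ?invr_ge0 ?ltW// -(powR_inv1 (ltW P0)).
rewrite -powRrM mulN1r powRN.
by rewrite -powR_mulrn ?ltW// -powRrM mulfV ?pnatr_eq0 -?lt0n// powRr1// ltW.
Qed.

Lemma capacity_ratio_le (R : realType) (n k : nat)
    (c : set (Cn R n) -> \bar R) (a b : 'rV[R]_n) (s t : R) :
  (0 < n)%N -> (0 < k)%N -> normalized_capacity k c -> positive a -> positive b ->
  is_kth_multiple a k s -> is_kth_multiple b k t ->
  (capacity_ratio c (ellipsoid b) <= capacity_ratio c (ellipsoid a))%E =
  (t ^+ n / \prod_j b 0 j <= s ^+ n / \prod_j a 0 j).
Proof.
move=> n0 k0 cn a0 b0 sk tk; have [s0 _ _] := sk; have [t0 _ _] := tk.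
rewrite (capacity_ratio_ellipsoid n0 k0 cn a0 sk).
rewrite (capacity_ratio_ellipsoid n0 k0 cn b0 tk) lee_fin.
have inv_n0 : 0 < n%:R^-1 :> R by rewrite invr_gt0 ltr0n.
have quot_ge0 (u : R) (e : 'rV[R]_n) : 0 < u -> positive e ->
    u ^+ n / (\prod_j e 0 j) \in Num.nneg.
  move=> u0 e0; rewrite nnegrE divr_ge0 ?exprn_ge0 ?ltW//.
  by apply: prodr_gt0.
apply/idP/idP; last by apply: ge0_ler_powR; rewrite ?quot_ge0// ltW.
by apply: contraTT; rewrite -!ltNge; apply: gt0_ltr_powR; rewrite ?quot_ge0.
Qed.

(** * Balanced ellipsoids and the indices k_m *)

(** The sum condition says that k - 1 multiples, namely p_j - 1 of each entry,
    lie below t. *)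
Definition balanced (R : realType) (n : nat) (a : 'rV[R]_n) (k : nat) (t : R)
    (p : 'I_n -> nat) : Prop :=
  [/\ 0 < t, forall j, t = (p j)%:R * a 0 j & (\sum_j p j).+1 = (k + n)%N].

Lemma common_multiple_sums (R : realType) (n : nat) (a : 'rV[R]_n) (t : R)
    (p : 'I_n -> nat) : positive a -> (forall j, t = (p j)%:R * a 0 j) ->
  ceil_sum a t = (\sum_j p j)%N /\ floor_sum a t = (\sum_j p j)%N.
Proof.
move=> a0 tp.
by split; apply: eq_bigr => j _; rewrite (tp j) mulfK ?gt_eqF// ?ceiln_natr ?natrK.
Qed.

Lemma common_multiple_gt0 (R : realType) (n : nat) (a : 'rV[R]_n) (t : R)
    (p : 'I_n -> nat) : positive a -> 0 < t -> (forall j, t = (p j)%:R * a 0 j) ->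
  forall j, (0 < p j)%N.
Proof.
by move=> a0 t0 tp j; move: t0; rewrite (tp j) pmulr_lgt0// ltr0n.
Qed.

Lemma common_multiple_sum_ge (R : realType) (n : nat) (a : 'rV[R]_n) (t : R)
    (p : 'I_n -> nat) : positive a -> 0 < t -> (forall j, t = (p j)%:R * a 0 j) ->
  (n <= \sum_j p j)%N.
Proof.
move=> a0 t0 tp; rewrite -[X in (X <= _)%N]card_ord -sum1_card.
by apply: leq_sum => j _; exact: common_multiple_gt0 tp j.
Qed.

Lemma balanced_is_kth_multiple (R : realType) (n k : nat) (a : 'rV[R]_n) (t : R)
    (p : 'I_n -> nat) : (0 < n)%N -> positive a -> balanced a k t p ->
  is_kth_multiple a k t.
Proof.
move=> n0 a0 [t0 tp sp]; have [cE fE] := common_multiple_sums a0 tp.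
by split=> //; rewrite ?cE ?fE; lia.
Qed.

Lemma balanced_rational (R : realType) (n k : nat) (a : 'rV[R]_n) (t : R)
    (p : 'I_n -> nat) : positive a -> balanced a k t p -> rational_ellipsoid a.
Proof.
move=> a0 [t0 tp _] j h; exists ((p h)%:R / (p j)%:R).
have p0 i : (p i)%:R != 0 :> R.
  by rewrite pnatr_eq0 -lt0n; exact: common_multiple_gt0 tp i.
have aE i : a 0 i = t / (p i)%:R by rewrite (tp i) mulrC mulKf.
rewrite fmorph_div/= !ratr_nat (aE j) (aE h).
by field; rewrite !p0 gt_eqF.
Qed.

(** With o a fixed index, common multiples are the m a_o for certain integers m.
    The least such m gives the period, and it divides all others since the
    remainder of a Euclidean division is again a common multiple. *)
Lemma period_dividing (R : realType) (n : nat) (a : 'rV[R]_n) (t : R)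
    (p : 'I_n -> nat) : (0 < n)%N -> positive a -> 0 < t ->
  (forall j, t = (p j)%:R * a 0 j) ->
  exists2 s, is_period a s & exists2 m : nat, (0 < m)%N & t = m%:R * s.
Proof.
move=> n0 a0 t0 tp; pose o := Ordinal n0.
pose common (m : nat) :=
  [forall j, `[< pos_multiple (a 0 j)%:E (m%:R * a 0 o) >]].
have commonP m :
    reflect (forall j, pos_multiple (a 0 j)%:E (m%:R * a 0 o)) (common m).
  by apply: (iffP forallP) => H j; apply/asboolP; exact: H.
have ex_common : exists m, (0 < m)%N && common m.
  exists (p o); rewrite (common_multiple_gt0 a0 t0 tp)/=; apply/commonP => j.
  rewrite -tp; apply/pos_multipleP; exists (p j) => //.
  exact: common_multiple_gt0 tp j.
have [m /andP[m0 /commonP mP] mmin] := ex_minnP ex_common.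
have s0 : 0 < m%:R * a 0 o by rewrite mulr_gt0 ?ltr0n.
have /choice[u uP] : forall j, exists u : nat, m%:R * a 0 o = u%:R * a 0 j.
  by move=> j; have /pos_multipleP[u _ uE] := mP j; exists u.
exists (m%:R * a 0 o).
  split=> [//|s /= [sgt0 sP]].
  have /pos_multipleP[m' m'0 sE] := sP o.
  rewrite sE ler_pM2r// ler_nat mmin// m'0; apply/commonP => j.
  by rewrite -sE.
have r0 : (p o %% m)%N = 0%N.
  apply/eqP; rewrite -leqn0 leqNgt; apply/negP => r_gt0.
  suff : (m <= p o %% m)%N by rewrite leqNgt ltn_mod m0.
  apply: mmin; rewrite r_gt0; apply/commonP => j.
  have rE : (p o %% m)%:R * a 0 o =
      ((p j)%:R - (p o %/ m)%:R * (u j)%:R) * a 0 j.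
    rewrite mulrBl -mulrA -uP -tp (tp o) {2}(divn_eq (p o) m) natrD natrM; ring.
  have : 0 < (p o %% m)%:R * a 0 o by rewrite mulr_gt0// ltr0n.
  rewrite rE pmulr_lgt0// subr_gt0 -natrM ltr_nat => lt_pj.
  apply/pos_multipleP; exists (p j - p o %/ m * u j)%N; first by rewrite subn_gt0.
  by rewrite natrB ?natrM// ltnW.
have poE : p o = (p o %/ m * m)%N by rewrite {1}(divn_eq (p o) m) r0 addn0.
exists (p o %/ m)%N; last by rewrite mulrA -natrM -poE.
have := common_multiple_gt0 a0 t0 tp o; rewrite [X in (0 < X)%N]poE muln_gt0.
by case/andP.
Qed.

(** On common multiples floors and ceilings agree, so t is the j-th multiple
    exactly for the n values of j with j <= sum_j p_j < j + n. Balance singles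
    out the least of them. *)
Lemma mem_K_balanced (R : realType) (n k : nat)
    (c : nat -> set (Cn R n) -> \bar R) (a : 'rV[R]_n) :
  (0 < n)%N -> (0 < k)%N -> positive a ->
  (forall j, (1 <= j)%N -> normalized_capacity j (c j)) ->
  K c a k <-> exists t p, balanced a k t p.
Proof.
move=> n0 k0 a0 cn.
have cE j t : (0 < j)%N -> is_kth_multiple a j t -> c j (ellipsoid a) = t%:E.
  by move=> j0; exact: capacity_ellipsoid n0 j0 (cn _ j0) a0.
split=> [[m m0 [T [[T0 TP] _] [[_ ckE] kmin]]]|[t [p bal]]].
  have [t tk] := exists_kth_multiple n0 k0 a0.
  have tE : t = m%:R * T by have := cE _ _ k0 tk; rewrite ckE => -[].
  have /choice[u uP] : forall j, exists u : nat, T = u%:R * a 0 j.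
    by move=> j; have /pos_multipleP[u _ uE] := TP j; exists u.
  have tp j : t = (m * u j)%:R * a 0 j by rewrite natrM -mulrA -uP.
  exists t, (fun j => m * u j)%N; have [t0 + +] := tk.
  have [-> ->] := common_multiple_sums a0 tp => sum_lt sum_ge; split=> //.
  have := common_multiple_sum_ge a0 t0 tp.
  apply: contraPP => neq sum_n; have k1 : (0 < k.-1)%N by lia.
  have tk1 : is_kth_multiple a k.-1 t.
    by have [cs fs] := common_multiple_sums a0 tp; split; rewrite ?cs ?fs //; lia.
  have /kmin : (1 <= k.-1)%N /\ c k.-1 (ellipsoid a) = (m%:R * T)%:E.
    by rewrite -tE (cE _ _ k1 tk1).
  by rewrite leEnat; lia.
have tk := balanced_is_kth_multiple n0 a0 bal; case: bal => t0 tp sp.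
have [T perT [m m0 tE]] := period_dividing n0 a0 t0 tp.
exists m => //; exists T => //; split=> [|j [j0]].
  by split=> //; rewrite -tE -(cE _ _ k0 tk).
rewrite -tE; have [s sj] := exists_kth_multiple n0 j0 a0.
rewrite (cE _ _ j0 sj) => -[st]; rewrite st in sj.
have [_ + _] := sj; have [-> _] := common_multiple_sums a0 tp.
by rewrite leEnat; lia.
Qed.

(** * Local maximizers *)

Lemma prod_common_multiple (R : realType) (n : nat) (a : 'rV[R]_n) (t : R)
    (p : 'I_n -> nat) : (forall j, t = (p j)%:R * a 0 j) ->
  t ^+ n = (\prod_j (p j)%:R) * \prod_j a 0 j.
Proof.
move=> tp; rewrite -[X in t ^+ X]card_ord -prodr_const -big_split.
by apply: eq_bigr => j _; exact: tp.
Qed.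

(** Near a the intervals between (p_j - 1) b_j and p_j b_j have a common interior
    point for all j. A k-th multiple s of b above some p_h b_h lies above all
    (p_j - 1) b_j as well, so at least sum_j (p_j - 1) + 1 = k multiples lie
    below s. *)
Lemma balanced_local_maximizer (R : realType) (n k : nat)
    (c : set (Cn R n) -> \bar R) (a : 'rV[R]_n) (t : R) (p : 'I_n -> nat) :
  (0 < n)%N -> (0 < k)%N -> normalized_capacity k c -> positive a ->
  balanced a k t p ->
  local_maximizer (fun b => capacity_ratio c (ellipsoid b)) a.
Proof.
move=> n0 k0 cn a0 bal; split=> //.
have tk := balanced_is_kth_multiple n0 a0 bal.
case: bal => t0 tp sp; have p0 := common_multiple_gt0 a0 t0 tp.
pose separated (jh : 'I_n * 'I_n) (b : 'rV[R]_n) : Prop :=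
  (p jh.1).-1%:R * b 0 jh.1 < (p jh.2)%:R * b 0 jh.2.
have near_sep : \forall b \near a, forall jh, separated jh b.
  apply: (@filter_forall _ _ separated (nbhs a)) => -[j h] /=.
  pose f (b : 'rV[R]_n) := (p h)%:R * b 0 h - (p j).-1%:R * b 0 j.
  have cf : f b @[b --> a] --> f a.
    have cvg_scale (m : nat) i :
        m%:R * (b : 'rV[R]_n) 0 i @[b --> a] --> m%:R * a 0 i.
      have cc := @coord_continuous R 1 n 0 i a.
      exact: (cvgM (cvg_cst (m%:R : R)) cc).
    exact: (cvgB (cvg_scale _ _) (cvg_scale _ _)).
  have fa0 : 0 < f a.
    rewrite subr_gt0 -tp [X in _ < X](tp j) ltr_pM2r// ltr_nat ltn_predL.
    exact: p0.
  have f_gt0 := cvgr_gt _ cf _ fa0.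
  near=> b; rewrite /separated -subr_gt0 -/(f b); near: b.
  exact: f_gt0.
near=> b => b0; have sep : forall jh, separated jh b by near: b.
have [s sk] := exists_kth_multiple n0 k0 b0.
rewrite (capacity_ratio_le n0 k0 cn a0 b0 tk sk).
have Pa : 0 < \prod_j a 0 j by apply: prodr_gt0.
have Pb : 0 < \prod_j b 0 j by apply: prodr_gt0.
rewrite (prod_common_multiple tp) mulfK ?gt_eqF// ler_pdivrMr//.
rewrite -big_split -[X in _ ^+ X]card_ord -prodr_const.
case: sk => s0 sk _; apply: ler_prod => h _; rewrite ltW//=.
rewrite leNgt; apply/negP => sh; move: sk; apply/negP; rewrite -leqNgt -sp.
rewrite /ceil_sum (bigD1 h)//= [X in (_ <= X)%N](bigD1 h)//= -addSn.
apply: leq_add.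
  by rewrite ceiln_gt_nat ?divr_ge0 ?ltW// ltr_pdivlMr.
apply: leq_sum => j _; rewrite -(prednK (p0 j)).
rewrite ceiln_gt_nat ?divr_ge0 ?(ltW s0) ?(ltW (b0 _))// ltr_pdivlMr//.
exact: lt_trans (sep (j, h)) sh.
Unshelve. all: end_near. Qed.

Definition replace_entry (R : realType) (n : nat) (a : 'rV[R]_n) (j : 'I_n)
    (x : R) : 'rV[R]_n := \row_i (if i == j then x else a 0 i).

(** Decreasing a_j keeps all floors at least as large. The bound on x from below
    keeps t/x at most floor(t/a_j) + 1, so at most one more multiple of the j-th
    entry drops below t. *)
Lemma replace_entry_is_kth_multiple (R : realType) (n k : nat) (a : 'rV[R]_n)
    (t x : R) (j : 'I_n) : positive a -> is_kth_multiple a k t ->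
  t / (Num.truncn (t / a 0 j)).+1%:R <= x <= a 0 j ->
  (\sum_(i | i != j) ceiln (t / a 0 i)%R +
    (Num.truncn (t / a 0 j)%R).+1 < k + n)%N ->
  is_kth_multiple (replace_entry a j x) k t.
Proof.
move=> a0 [t0 _ kt] /andP[xge xle] small.
have x0 : 0 < x by apply: lt_le_trans xge; rewrite divr_gt0.
split=> //.
  apply: leq_ltn_trans small; rewrite /ceil_sum (bigD1 j)//= addnC leq_add//.
    by apply: leq_sum => i ij; rewrite mxE (negbTE ij).
  rewrite mxE eqxx ceiln_le_nat; last by rewrite divr_ge0 ?ltW.
  by rewrite ler_pdivrMr// mulrC -ler_pdivrMr.
apply: leq_trans kt _; apply: leq_sum => i _; apply: le_truncn.
rewrite ler_pM2l// mxE; case: eqP => [->|//].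
by rewrite lef_pV2 ?posrE.
Qed.

Lemma replace_entry_prod (R : realType) (n : nat) (a : 'rV[R]_n) (j : 'I_n)
    (x : R) : positive a -> x < a 0 j ->
  \prod_i (replace_entry a j x) 0 i < \prod_i a 0 i.
Proof.
move=> a0 xa; rewrite (bigD1 j)//= [X in _ < X](bigD1 j)//= mxE eqxx.
have -> : \prod_(i | i != j) (replace_entry a j x) 0 i = \prod_(i | i != j) a 0 i.
  by apply: eq_bigr => i ij; rewrite mxE (negbTE ij).
by rewrite ltr_pM2r//; apply: prodr_gt0.
Qed.

(** Since no entry can be decreased, each ceiling equals the corresponding floor
    and the sum of the ceilings is as large as it can be for a k-th multiple. *)
Lemma local_maximizer_balanced (R : realType) (n k : nat)
    (c : set (Cn R n) -> \bar R) (a : 'rV[R]_n) :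
  (0 < n)%N -> (0 < k)%N -> normalized_capacity k c ->
  local_maximizer (fun b => capacity_ratio c (ellipsoid b)) a ->
  exists t p, balanced a k t p.
Proof.
move=> n0 k0 cn [a0 /nbhs_ballP[e /= e0 amax]].
have [t tk] := exists_kth_multiple n0 k0 a0.
exists t, (fun j => Num.truncn (t / a 0 j)); have [t0 ceil_lt _] := tk.
have ta0 i : 0 <= t / a 0 i by rewrite divr_ge0 ?ltW.
have full j : (k + n <= \sum_(i | i != j) ceiln (t / a 0 i)%R +
    (Num.truncn (t / a 0 j)%R).+1)%N.
  rewrite leqNgt; apply/negP => small.
  (* Within e of a_j, and large enough for replace_entry_is_kth_multiple. *)
  pose x := Num.max (a 0 j - e / 2) (t / (Num.truncn (t / a 0 j)).+1%:R).
  have e20 : 0 < e / 2 by rewrite divr_gt0.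
  have xa : x < a 0 j.
    rewrite /x gt_max ltrBlDr ltrDl e20/= ltr_pdivrMr// mulrC -ltr_pdivrMr//.
    exact: truncnS_gt.
  have x0 : 0 < x.
    by apply: (@lt_le_trans _ _ (t / (Num.truncn (t / a 0 j)).+1%:R));
      rewrite ?divr_gt0// /x le_max lexx orbT.
  have bk : is_kth_multiple (replace_entry a j x) k t.
    apply: replace_entry_is_kth_multiple => //.
    by rewrite (ltW xa) andbT /x le_max lexx orbT.
  have b0 : positive (replace_entry a j x) by move=> i; rewrite mxE; case: ifP.
  have near_b : ball a e (replace_entry a j x).
    split=> // i i'; rewrite ord1 mxE; case: eqP => [->|_]; last exact: ballxx.
    rewrite /ball/= ger0_norm ?subr_ge0 ?ltW//.
    have : a 0 j - e / 2 <= x by rewrite /x le_max lexx.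
    by lra.
  have := amax _ near_b b0; rewrite (capacity_ratio_le n0 k0 cn a0 b0 tk bk).
  rewrite ler_pM2l ?exprn_gt0// lef_pV2 ?posrE ?prodr_gt0// leNgt.
  by rewrite replace_entry_prod.
have floorE j : t / a 0 j = (Num.truncn (t / a 0 j))%:R.
  apply: ceiln_le_truncn_natr => //.
  have := full j; move: ceil_lt; rewrite /ceil_sum (bigD1 j)//=.
  by set u := bigop _ _ _; lia.
have tp j : t = (Num.truncn (t / a 0 j))%:R * a 0 j.
  by rewrite -floorE divfK ?gt_eqF.
split=> //.
have := full (Ordinal n0); move: ceil_lt.
have [-> _] := common_multiple_sums a0 tp.
have -> : (\sum_(i | i != Ordinal n0) ceiln (t / a 0 i)%R =
   \sum_(i | i != Ordinal n0) Num.truncn (t / a 0 i)%R)%N.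
  by apply: eq_bigr => i _; rewrite {1}floorE ceiln_natr.
rewrite (bigD1 (Ordinal n0))//=; set u := bigop _ _ _; lia.
Qed.

(** * Products of integers with bounded sum *)

Lemma ltr_bernoulli (R : realFieldType) (h : R) (e : nat) :
  0 < h -> (1 < e)%N ->
  1 + e%:R * h < (1 + h) ^+ e.
Proof.
move=> h0; case: e => [//|[//|e]] _; elim: e => [|e IHe].
  by rewrite expr2; nra.
have e0 : 0 <= e.+2%:R :> R by [].
by rewrite exprS -[e.+3%:R]natr1; nra.
Qed.

Lemma ltr_bernoulli_dual (R : realFieldType) (h : R) (e : nat) :
  0 < h -> (0 < e)%N ->
  (1 - e%:R * h) * (1 + h) ^+ e < 1.
Proof.
move=> h0; case: e => [//|e] _; elim: e => [|e]; first by rewrite expr1; nra.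
have : 0 < (1 + h) ^+ e.+1 by rewrite exprn_gt0//; lra.
rewrite [(1 + h) ^+ e.+2]exprS -[e.+2%:R]natr1; set u := _ ^+ _ => u0.
apply: le_lt_trans.
have e0 : 0 <= e.+1%:R :> R by [].
rewrite mulrA ler_pM2r//; nra.
Qed.

(** The geometric progression through (x, x) and (x+1, x+1), with ratio
    g = 1 + 1/x, is convex, so on the integers it lies above the identity and
    touches it at these two points only. *)
Lemma natr_le_geometric (R : realFieldType) (x p : nat) : (0 < x)%N ->
  let g := 1 + x%:R^-1 :> R in
  p%:R * g ^+ x <= x%:R * g ^+ p ?= iff ((p == x) || (p == x.+1)).
Proof.
move=> x0 g; have xr0 : 0 < x%:R :> R by rewrite ltr0n.
have h0 : 0 < x%:R^-1 :> R by rewrite invr_gt0.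
have g0 : 0 < g by rewrite /g; lra.
have gx m : 0 < g ^+ m by rewrite exprn_gt0.
have strict (u v : R) : u < v -> u <= v ?= iff false.
  by move=> uv; split; [exact: ltW|exact: lt_eqF].
have [xp|px|->] := ltngtP x p; last 1 first.
- by split; rewrite // eqxx.
- have [->|px1] := eqVneq p x.+1.
    have -> : x.+1%:R * g ^+ x = x%:R * g ^+ x.+1.
      by rewrite exprS mulrA -natr1 /g; congr (_ * _); field; rewrite gt_eqF.
    by split; rewrite // eqxx orbT.
  apply: strict; have e1 : (1 < p - x)%N by lia.
  have := ltr_bernoulli h0 e1; rewrite -/g => lt_e.
  rewrite -{1 2}(subnKC (ltnW xp)) exprD natrD.
  have -> : x%:R + (p - x)%:R = x%:R * (1 + (p - x)%:R / x%:R) :> R.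
    by field; rewrite gt_eqF.
  by rewrite -mulrA ltr_pM2l// mulrC ltr_pM2l.
- have -> : (p == x.+1) = false by lia.
  apply: strict; have e0 : (0 < x - p)%N by rewrite subn_gt0.
  have := ltr_bernoulli_dual h0 e0; rewrite -/g => lt_e.
  rewrite -{1}(subnKC (ltnW px)) exprD -{1}(subKn (ltnW px)).
  rewrite natrB ?leq_subr//.
  have -> : x%:R - (x - p)%:R = x%:R * (1 - (x - p)%:R / x%:R) :> R.
    by field; rewrite gt_eqF.
  rewrite -mulrA ltr_pM2l// mulrCA -[ltRHS]mulr1 ltr_pM2l//.
Qed.

(** Multiplying the inequalities of [natr_le_geometric] leaves a power of g that
    depends on the sum of the p_j alone and increases with it. *)
Lemma prod_le_geometric (R : realFieldType) (n x d : nat) (p : 'I_n -> nat) :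
  (0 < x)%N -> (\sum_j p j <= n * x + d)%N ->
  \prod_j (p j)%:R <= x%:R ^+ n * (1 + x%:R^-1) ^+ d
    ?= iff [forall j, (p j == x) || (p j == x.+1)] && (\sum_j p j == n * x + d)%N
    :> R.
Proof.
move=> x0 sum_le; set g : R := 1 + x%:R^-1.
have xr0 : 0 < x%:R :> R by rewrite ltr0n.
have g1 : 1 < g by rewrite /g ltrDl invr_gt0.
have g0 : 0 < g by apply: lt_trans g1.
have gx m : 0 < g ^+ m by rewrite exprn_gt0.
rewrite -(mono_leif (ler_pM2r (gx (n * x)%N))).
rewrite -mulrA -exprD [(d + _)%N]addnC.
have lhsE : \prod_j (p j)%:R * g ^+ (n * x) = \prod_j ((p j)%:R * g ^+ x).
  by rewrite big_split/= prodr_const card_ord -exprM mulnC.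
have rhsE : \prod_j (x%:R * g ^+ p j) = x%:R ^+ n * g ^+ (\sum_j p j).
  by rewrite big_split/= prodr_const card_ord prodrXr.
rewrite lhsE; apply: leif_trans.
  have := @leif_pprod _ _ xpredT _ _ (fun j => x%:R * g ^+ p j)
    (fun j _ => mulr_ge0 (ler0n R (p j)) (ltW (gx x)))
    (fun j _ => natr_le_geometric R (p j) x0).
  rewrite /=.
  have /negbTE -> : \prod_j (x%:R * g ^+ p j) != 0.
    by rewrite gt_eqF// rhsE mulr_gt0 ?exprn_gt0.
  by rewrite rhsE; apply.
rewrite (mono_leif (ler_pM2l (exprn_gt0 n xr0))).
split; first by rewrite ler_eXn2l.
by rewrite (inj_eq (ieexprIn g0 (negbT (gt_eqF g1)))).
Qed.

(** * Global maximizers *)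

(** Two inequalities are combined, t <= p_j a_j with p_j = ceil(t/a_j) and the
    bound on prod_j p_j; the second part reads off both cases of equality. *)
Lemma kth_multiple_quotient (R : realType) (n q d : nat) (a : 'rV[R]_n) (t : R) :
  positive a -> is_kth_multiple a (q * n + d.+1)%N t ->
  let M := q.+1%:R ^+ n * (1 + q.+1%:R^-1) ^+ d in
  t ^+ n / \prod_j a 0 j <= M /\
  (M <= t ^+ n / \prod_j a 0 j ->
   exists2 p, balanced a (q * n + d.+1)%N t p &
     forall j, p j = q.+1 \/ p j = q.+2).
Proof.
move=> a0 [t0 ceil_lt _] M; pose p j := ceiln (t / a 0 j).
have Pa : 0 < \prod_j a 0 j by apply: prodr_gt0.
have le_t j : t <= (p j)%:R * a 0 j.
  by rewrite -ler_pdivrMr// ceiln_ge// divr_ge0 ?ltW.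
have sum_p : (\sum_j p j <= n * q.+1 + d)%N.
  have : (\sum_j p j < q * n + d.+1 + n)%N := ceil_lt.
  by lia.
have prod_p := prod_le_geometric R (ltn0Sn q) sum_p; rewrite -/M in prod_p.
have prod_t : t ^+ n <= (\prod_j (p j)%:R) * \prod_j a 0 j
    ?= iff (\prod_j ((p j)%:R * a 0 j) == 0) ||
           [forall j, t == (p j)%:R * a 0 j].
  rewrite -big_split -[X in t ^+ X]card_ord -prodr_const.
  apply: leif_pprod => j _; first exact: ltW.
  exact: (leif_eq (le_t j)).
have prod_neq0 : \prod_j ((p j)%:R * a 0 j) != 0.
  by rewrite gt_eqF//; apply: prodr_gt0 => j _; exact: lt_le_trans (le_t j).
rewrite (negbTE prod_neq0)/= in prod_t.
split.
  rewrite ler_pdivrMr//; apply: le_trans prod_t.1 _.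
  by rewrite ler_pM2r// prod_p.1.
rewrite ler_pdivlMr// => geM.
have pM : \prod_j (p j)%:R = M.
  apply/le_anti; rewrite prod_p.1 -(ler_pM2r Pa); exact: le_trans prod_t.1.
have tE : t ^+ n = (\prod_j (p j)%:R) * \prod_j a 0 j.
  by apply/le_anti; rewrite prod_t.1 pM.
move/eqP: pM; rewrite prod_p => /andP[/forallP p_two /eqP sumE].
move/eqP: tE; rewrite prod_t => /forallP tp.
exists p; last by move=> j; have /orP[/eqP->|/eqP->] := p_two j; [left|right].
split=> //; [by move=> j; apply/eqP|by rewrite sumE; lia].
Qed.

Lemma balanced_quotient (R : realType) (n q d : nat) (a : 'rV[R]_n) (t : R)
    (p : 'I_n -> nat) : positive a -> balanced a (q * n + d.+1)%N t p ->
  (forall j, p j = q.+1 \/ p j = q.+2) ->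
  t ^+ n / \prod_j a 0 j = q.+1%:R ^+ n * (1 + q.+1%:R^-1) ^+ d.
Proof.
move=> a0 [t0 tp sp] p_two.
have sumE : (\sum_j p j = n * q.+1 + d)%N by lia.
rewrite (prod_common_multiple tp) mulfK; last by rewrite gt_eqF//; apply: prodr_gt0.
have le_sum : (\sum_j p j <= n * q.+1 + d)%N by rewrite sumE.
apply/eqP; rewrite (prod_le_geometric R (ltn0Sn q) le_sum) sumE eqxx andbT.
by apply/forallP => j; have [->|->] := p_two j; rewrite eqxx ?orbT.
Qed.

Lemma perm_sorting_set (n : nat) (A : {set 'I_n}) :
  exists s : 'S_n, forall i, (s i \in A) = (i < #|A|)%N.
Proof.
pose e := enum A ++ enum (~: A).
have size_e : size e = n.
  by rewrite size_cat -!cardE cardsC card_ord.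
have uniq_e : uniq e.
  rewrite cat_uniq !enum_uniq andbT/=; apply/hasPn => j.
  by rewrite !mem_enum inE.
pose f (i : 'I_n) := nth i e i.
have f_inj : injective f.
  move=> i j; rewrite /f (set_nth_default j) ?size_e// => /eqP.
  by rewrite nth_uniq ?size_e// => /eqP/val_inj.
exists (perm f_inj) => i; rewrite permE /f nth_cat -cardE.
case: ltnP => [lt_i|ge_i].
  by rewrite -mem_enum mem_nth// -cardE.
apply/negbTE; rewrite -finset.in_setC -mem_enum mem_nth// -cardE.
by rewrite ltn_subLR// cardsC card_ord.
Qed.

Lemma sum_lt_ord (n d : nat) : (d <= n)%N -> (\sum_(i < n) (i < d) = d)%N.
Proof.
move=> dn;
rewrite (eq_bigr (fun i : 'I_n => if (i < d)%N then 1%N else 0%N)); last first.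
  by move=> i _; case: ifP.
by rewrite -big_mkcond (big_ord_narrow dn) sum1_card card_ord.
Qed.

(** Because a_j = t/p_j, an entry is the largest one if p_j = q+1 and is smaller
    by the factor (q+1)/(q+2) if p_j = q+2. The sum condition makes the second
    case occur d times, and the permutation brings it to the first d indices. *)
Lemma balanced_shapeP (R : realType) (n q d : nat) (a : 'rV[R]_n) :
  (d < n)%N -> positive a ->
  (exists t p, balanced a (q * n + d.+1)%N t p /\
     forall j, p j = q.+1 \/ p j = q.+2) <->
  (exists s : 'S_n, forall i l : 'I_n, l.+1 = n ->
     a 0 (s i) / a 0 (s l) = if (i < d)%N then q.+1%:R / q.+2%:R else 1).
Proof.
move=> dn a0; split.
  move=> [t [p [[t0 tp sp] p_two]]].
  have pE j : p j = (q.+1 + (p j == q.+2))%N by case: (p_two j) => ->; lia.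
  pose A : {set 'I_n} := [set j | p j == q.+2]%SET.
  have cardA : #|A| = d.
    have : (\sum_j p j = n * q.+1 + #|A|)%N.
      under eq_bigr do rewrite pE.
      rewrite big_split/= sum_nat_const card_ord; congr (_ + _)%N.
      rewrite -sum1_card [RHS]big_mkcond; apply: eq_bigr => j _.
      by rewrite /A inE; case: eqP.
    by lia.
  have [s sA] := perm_sorting_set A; exists s => i l lE.
  have ps j : p (s j) = (q.+1 + (j < d))%N by rewrite pE -cardA -sA /A inE.
  have pl : p (s l) = q.+1 by rewrite ps; lia.
  have aE j : a 0 (s j) = t / (p (s j))%:R.
    rewrite (tp (s j)) mulrC mulKf// pnatr_eq0 -lt0n.
    exact: common_multiple_gt0 tp _.
  rewrite !aE pl ps; case: ifP => _.
    by rewrite addn1; field; rewrite gt_eqF//= !lt0r_neq0.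
  by rewrite addn0 divff// mulf_neq0 ?gt_eqF// invr_gt0.
move=> [s shape].
have n0 : (0 < n)%N by lia.
have ltl : (n.-1 < n)%N by rewrite prednK.
pose l := Ordinal ltl; have lE : l.+1 = n by rewrite /= prednK.
pose p j := (q.+1 + (s^-1%g j < d))%N.
exists (q.+1%:R * a 0 (s l)), p; split; last first.
  move=> j; rewrite /p.
  by case: (_ < d)%N; [right; rewrite addn1|left; rewrite addn0].
split; first by rewrite mulr_gt0.
  move=> j; have := shape (s^-1%g j) l lE; rewrite permKV /p => shape_j.
  rewrite -[a 0 j](divfK (lt0r_neq0 (a0 (s l)))) shape_j mulrA.
  case: (_ < d)%N; last by rewrite addn0 mulr1.
  by rewrite addn1 mulrCA divff ?mulr1// lt0r_neq0.
rewrite (reindex_inj (@perm_inj _ s))/=.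
under eq_bigr do rewrite /p permK.
rewrite big_split/= sum_nat_const card_ord (sum_lt_ord (ltnW dn)); lia.
Qed.

Lemma optimum_root (R : realType) (n q d : nat) : (d < n)%N ->
  (q.+1%:R ^+ n * (1 + q.+1%:R^-1) ^+ d : R) `^ n%:R^-1 =
  q.+1%:R `^ ((n%:R - d.+1%:R + 1) / n%:R) * q.+2%:R `^ ((d.+1%:R - 1) / n%:R).
Proof.
move=> dn.
have -> : (q.+1%:R ^+ n * (1 + q.+1%:R^-1) ^+ d : R) =
    q.+1%:R ^+ (n - d) * q.+2%:R ^+ d.
  rewrite -{1}(subnK (ltnW dn)) exprD -mulrA -exprMn; congr (_ * _ ^+ _).
  by rewrite -[q.+2%:R]natr1; field; rewrite lt0r_neq0.
rewrite powRM ?exprn_ge0// -!powR_mulrn// -!powRrM.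
have -> : (n - d)%:R = n%:R - d.+1%:R + 1 :> R.
  rewrite (natrB _ (ltnW dn)) -[d.+1%:R]natr1. ring.
have -> : d%:R = d.+1%:R - 1 :> R.
  by rewrite -[d.+1%:R]natr1 addrK.
by [].
Qed.

Lemma exists_balanced (R : realType) (n q d : nat) : (d < n)%N ->
  exists2 a : 'rV[R]_n, positive a &
    exists t p, balanced a (q * n + d.+1)%N t p /\
      forall j, p j = q.+1 \/ p j = q.+2.
Proof.
move=> dn; pose p (j : 'I_n) := (q.+1 + (j < d))%N.
(* With t = 1 the entries have to be the 1/p_j. *)
exists (\row_j (p j)%:R^-1); first by move=> j; rewrite mxE invr_gt0 ltr0n.
exists 1, p; split; last first.
  move=> j; rewrite /p.
  by case: (_ < d)%N; [right; rewrite addn1|left; rewrite addn0].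
split=> //; first by move=> j; rewrite mxE mulfV// pnatr_eq0.
by rewrite big_split/= sum_nat_const card_ord (sum_lt_ord (ltnW dn)); lia.
Qed.

Theorem proposition3 (R : realType) (n k : nat)
    (ck : set (Cn R n) -> \bar R) :
  (2 <= n)%N -> (1 <= k)%N -> symplectic_capacity k ck ->
  let ratio (a : 'rV[R]_n) : \bar R := capacity_ratio ck (ellipsoid a) in
  (forall c : nat -> set (Cn R n) -> \bar R,
     (forall j, (1 <= j)%N -> normalized_capacity j (c j)) ->
     forall a : 'rV[R]_n,
       local_maximizer ratio a <->
       [/\ positive a, rational_ellipsoid a & K c a k]) /\
  (forall q r : nat, (1 <= r <= n)%N -> k = (q * n + r)%N ->
     (exists2 a : 'rV[R]_n, global_maximizer ratio a &
        ratio a = ((q.+1%:R `^ ((n%:R - r%:R + 1) / n%:R)) *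
                   (q.+2%:R `^ ((r%:R - 1) / n%:R)))%:E) /\
     (forall a : 'rV[R]_n,
        global_maximizer ratio a <->
        [/\ positive a, rational_ellipsoid a &
          exists s : 'S_n, forall i l : 'I_n, l.+1 = n ->
            a 0 (s i) / a 0 (s l) =
              if (1 < r)%N && (i.+1 <= r.-1)%N
              then q.+1%:R / q.+2%:R else 1])).
Proof.
move=> n2 k0 [_ _ _ cn] ratio; have n0 : (0 < n)%N by exact: ltnW.
split=> [c cnorm a|q [//|d] /= dn kE].
  split=> [amax|[a0 _ /(mem_K_balanced n0 k0 a0 cnorm)[t [p bal]]]].
    have [t [p bal]] := local_maximizer_balanced n0 k0 cn amax.
    have [a0 _] := amax; split=> //; first exact: balanced_rational bal.
    by apply/(mem_K_balanced n0 k0 a0 cnorm); exists t, p.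
  exact: balanced_local_maximizer bal.
rewrite kE in k0 cn.
pose M : R := q.+1%:R ^+ n * (1 + q.+1%:R^-1) ^+ d.
have [e e0 [u [m [e_bal m_two]]]] := exists_balanced R q dn.
have ek := balanced_is_kth_multiple n0 e0 e_bal.
have e_quot := balanced_quotient e0 e_bal m_two.
have maximizerP a : global_maximizer ratio a <-> positive a /\
    exists t p, balanced a (q * n + d.+1)%N t p /\
      forall j, p j = q.+1 \/ p j = q.+2.
  split=> [[a0 amax]|[a0 [t [p [bal p_two]]]]]; split=> //.
    have [t tk] := exists_kth_multiple n0 k0 a0.
    have := amax e e0; rewrite (capacity_ratio_le n0 k0 cn a0 e0 tk ek) e_quot.
    by move=> /(kth_multiple_quotient a0 tk).2[p bal p_two]; exists t, p.
  move=> b b0; have [s sk] := exists_kth_multiple n0 k0 b0.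
  have tk := balanced_is_kth_multiple n0 a0 bal.
  rewrite (capacity_ratio_le n0 k0 cn a0 b0 tk sk) (balanced_quotient a0 bal p_two).
  exact: (kth_multiple_quotient b0 sk).1.
split.
  exists e; first by apply/maximizerP; split=> //; exists u, m.
  by rewrite /ratio (capacity_ratio_ellipsoid n0 k0 cn e0 ek) e_quot optimum_root.
have condE (i : 'I_n) : (1 < d.+1)%N && (i.+1 <= d)%N = (i < d)%N by lia.
move=> a; rewrite maximizerP; split=> [[a0 bal]|[a0 _ [s shape]]].
  have /(balanced_shapeP q dn a0)[s shape] := bal.
  have [t [p [balp _]]] := bal; split=> //; first exact: balanced_rational balp.
  by exists s => i l lE; rewrite condE; exact: shape.
split=> //; apply/(balanced_shapeP q dn a0); exists s => i l lE.
by rewrite shape// condE.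
Qed.
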